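(* For every integer $d \geq 5$, the complete bipartite graph $K_{3,d}$ satisfies $\chi'_{st}(K_{3,d}) = 3\left\lceil \frac{d}{2} \right\rceil$.
   Context: A star edge coloring of a graph is a proper edge coloring in which there is no path or cycle of length four (i.e., with four edges) whose edges use only two colors. The star chromatic index $\chi'_{st}(G)$ is the minimum number $t$ such that $G$ has a star edge coloring with $t$ colors. *)

(* Defs.v *)
From mathcomp Require Import all_boot.

Set Implicit Arguments.
Unset Strict Implicit.
Unset Printing Implicit Defensive.

Record sgraph := SGraph {
  vertex :> finType;
  adj : rel vertex;
  adj_sym : symmetric adj;
  adj_irr : irreflexive adj }.

Definition edge_set (G : sgraph) : {set {set G}} :=
  [set [set p.1; p.2] | p : G * G & adj p.1 p.2].

Definition edge (G : sgraph) : finType := {e : {set G} | e \in edge_set G}.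

Section StarEdgeColoring.

Variable G : sgraph.
Implicit Types (x : G) (p : seq G) (s : seq (edge G)).

(* s is the list of edges successively traversed by the vertex list x :: p;
   as the items of s are edges, consecutive vertices are adjacent. *)
Definition traverses x p s : bool :=
  [seq val a | a <- s] == pairmap (fun u v => [set u; v]) x p.

Definition path_edges x p s : bool := uniq (x :: p) && traverses x p s.

Definition cycle_edges x p s : bool :=
  [&& 2 < size (x :: p), uniq (x :: p) & traverses x (rcons p x) s].

Definition proper_edge_coloring (C : eqType) (c : edge G -> C) : bool :=
  [forall a : edge G, forall b : edge G,
    (a != b) && ~~ [disjoint val a & val b] ==> (c a != c b)].

(* "Only two colors" is read as "at most two colors"; for four consecutive
   edges of a properly colored graph this is the same as "exactly two". *)
Definition bicolored (C : eqType) (c : edge G -> C) s : bool :=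
  size (undup [seq c a | a <- s]) <= 2.

Definition star_edge_coloring (C : eqType) (c : edge G -> C) : bool :=
  [&& proper_edge_coloring c,
      [forall x : G, forall p : 4.-tuple G, forall s : 4.-tuple (edge G),
        path_edges x p s ==> ~~ bicolored c s]
    & [forall x : G, forall p : 3.-tuple G, forall s : 4.-tuple (edge G),
        cycle_edges x p s ==> ~~ bicolored c s]].

Definition star_edge_colorable (t : nat) : bool :=
  [exists c : {ffun edge G -> 'I_t}, star_edge_coloring c].

Lemma inj_not_bicolored (C : eqType) (c : edge G -> C) s :
  injective c -> uniq [seq val a | a <- s] -> 2 < size s -> ~~ bicolored c s.
Proof.
move=> inj_c /map_uniq us; rewrite -ltnNge undup_id ?size_map //.
by rewrite map_inj_uniq.
Qed.

Lemma eq_set2_head (T : finType) (u v y z : T) :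
  [set u; v] = [set y; z] -> (u == y) || (u == z).
Proof. by move/setP/(_ u); rewrite !inE eqxx. Qed.

Lemma set2_neq (T : finType) (u v y z : T) :
  (u != y) && (u != z) || (v != y) && (v != z) ->
  [set u; v] != [set y; z].
Proof.
move=> H; apply/eqP=> E; move: H.
have := eq_set2_head E; rewrite (setUC [set u]) in E.
by have := eq_set2_head E; do 4!case: eqP.
Qed.

Lemma star_edge_colorable_ex : exists t, star_edge_colorable t.
Proof.
exists #|edge G|; apply/existsP; exists [ffun a => enum_rank a].
have inj_c : injective [ffun a : edge G => enum_rank a].
  by move=> a b; rewrite !ffunE => /enum_rank_inj.
apply/and3P; split.
- apply/forallP=> a; apply/forallP=> b; apply/implyP=> /andP[nab _].
  by rewrite (inj_eq inj_c).
- apply/forallP=> x; apply/forallP=> p; apply/forallP=> s.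
  apply/implyP=> /andP[up /eqP es].
  apply: inj_not_bicolored; rewrite ?size_tuple // es => {es s}.
  case: p up => -[|a [|b [|c [|d [|? ?]]]]] //= _.
  rewrite !inE !negb_or -!andbA => up.
  by apply/and5P; split=> //; rewrite ?andbT; repeat (apply/andP; split);
     apply: set2_neq; move: up; do ![case: (eqVneq _ _) => //= _].
- apply/forallP=> x; apply/forallP=> p; apply/forallP=> s.
  apply/implyP=> /and3P[_ up /eqP es].
  apply: inj_not_bicolored; rewrite ?size_tuple // es => {es s}.
  case: p up => -[|a [|b [|c [|? ?]]]] //= _.
  rewrite !inE !negb_or -!andbA => up.
  by apply/and5P; split=> //; rewrite ?andbT; repeat (apply/andP; split);
     apply: set2_neq; move: up; rewrite ?[_ == x]eq_sym;
     do ![case: (eqVneq _ _) => //= _].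
Qed.

Definition star_chromatic_index : nat := ex_minn star_edge_colorable_ex.

End StarEdgeColoring.

Definition bipartite_adj (m n : nat) : rel ('I_m + 'I_n)%type :=
  fun u v => is_inl u != is_inl v.

Lemma bipartite_adj_sym m n : symmetric (@bipartite_adj m n).
Proof. by move=> u v; rewrite /bipartite_adj eq_sym. Qed.

Lemma bipartite_adj_irr m n : irreflexive (@bipartite_adj m n).
Proof. by move=> u; rewrite /bipartite_adj eqxx. Qed.

Definition complete_bipartite (m n : nat) : sgraph :=
  SGraph (@bipartite_adj_sym m n) (@bipartite_adj_irr m n).

(* Main.v *)
Require Import Defs.
From mathcomp Require Import all_boot zify.

Set Implicit Arguments.
Unset Strict Implicit.
Unset Printing Implicit Defensive.

(** A coloring of K_{3,d} is a 3 x d array of colors. Being a star coloring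
    forbids that, in some column, the color in row r also occurs in row s while
    the color in row s also occurs in row r. Hence at most d/2 colors are common
    to rows r and s, and inclusion-exclusion leaves at least
    3d - 3 floor(d/2) = 3 ceil(d/2) colors.
    Conversely, for k >= 3 use the colors (q, z) with q mod 3 and z mod k, and
    two kinds of columns x, y mod k: (r, x) in row r of the first kind, and
    (q, y + q) with q = r + 2 in row r of the second kind. Two distinct columns
    then share at most one color. *)

(** When consecutive colors differ, a list with at most two colors must alternate. *)
Lemma bicolored4 (G : sgraph) (C : eqType) (c : edge G -> C) (e f g h : edge G) :
  c e != c f -> c f != c g -> c g != c h ->
  bicolored c [:: e; f; g; h] = (c e == c g) && (c f == c h).
Proof.
rewrite /bicolored /= !inE => /negPf ef /negPf fg /negPf gh.
rewrite fg gh ef; have [eg|_] := eqVneq (c e) (c g).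
  by rewrite orbT; case: (_ == _).
have [eh|_] := eqVneq (c e) (c h); last by case: (_ == _).
by rewrite -eh eq_sym ef.
Qed.

(** * Edges of a complete bipartite graph as cells of an array *)

Section GridColoring.

Variables m n : nat.
Local Notation K := (complete_bipartite m n).

Fact grid_edge_subproof (r : 'I_m) (j : 'I_n) :
  [set inl r; inr j] \in edge_set K.
Proof. by apply/imsetP; exists (inl r : K, inr j : K); rewrite ?inE. Qed.

Definition grid_edge r j : edge K :=
  exist (fun e => e \in edge_set K) _ (grid_edge_subproof r j).

Lemma in_grid_edge r j (v : K) :
  (v \in val (grid_edge r j)) = (v == inl r) || (v == inr j).
Proof. by rewrite !inE. Qed.

Lemma grid_edge_inj r j s k : grid_edge r j = grid_edge s k -> r = s /\ j = k.
Proof.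
move=> /(congr1 val) /setP E.
have := E (inl r); have := E (inr j); rewrite !in_grid_edge !eqxx /=.
by move=> /esym/eqP[->] /esym; rewrite orbF => /eqP[->].
Qed.

Lemma grid_edge_ends (a : edge K) (u v : K) : val a = [set u; v] ->
  exists r j, a = grid_edge r j /\
    ((u = inl r /\ v = inr j) \/ (u = inr j /\ v = inl r)).
Proof.
move=> E; have /imsetP[[x y] /= xy Ea] := valP a.
have {xy Ea} [r [j Ea]] : exists r j, val a = [set inl r; inr j].
  move: xy Ea; rewrite inE /= /bipartite_adj.
  case: x y => [r|j] [s|k] //= _ ->; first by exists r, k.
  by exists s, j; rewrite setUC.
exists r, j; split; first exact: val_inj.
have := set22 u v; have := set21 u v; rewrite -{1 2}E Ea !inE.
have := set22 (inl r) (inr j : K); have := set21 (inl r) (inr j : K).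
rewrite -Ea E !inE.
by case: u {E} => ?; case: v => ?;
  rewrite //= ?orbF => /eqP[->] /eqP[->] _ _; [left|right].
Qed.

Lemma grid_edgeP (a : edge K) : exists r j, a = grid_edge r j.
Proof.
have /imsetP[[x y] _ /= /grid_edge_ends[r [j [-> _]]]] := valP a.
by exists r, j.
Qed.

Section Grid.

Variables (C : eqType) (c : edge K -> C).
Local Notation M r j := (c (grid_edge r j)).

Lemma proper_grid :
  proper_edge_coloring c <->
    (forall r, injective (fun j => M r j)) /\ (forall j, injective (fun r => M r j)).
Proof.
split=> [/forallP pc | [rowI colI]].
  have P (a b : edge K) (v : K) : v \in val a -> v \in val b -> c a = c b -> a = b.
    move=> va vb cab; apply/eqP; have /forallP/(_ b) := pc a.
    rewrite cab eqxx implybF negb_and !negbK => /orP[//|].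
    by move=> /disjointFr/(_ va); rewrite vb.
  split=> [r j k|j r s] E.
    by case: (grid_edge_inj (P _ _ (inl r) _ _ E)); rewrite ?in_grid_edge ?eqxx.
  by case: (grid_edge_inj (P _ _ (inr j) _ _ E)); rewrite ?in_grid_edge ?eqxx ?orbT.
apply/forallP=> a; apply/forallP=> b; apply/implyP=> /andP[nab].
have [r [j ?]] := grid_edgeP a; have [s [k ?]] := grid_edgeP b; subst a b.
move=> /pred0Pn[v] /=; rewrite !in_grid_edge => /andP[/orP[]/eqP-> /orP[]/eqP //];
  case=> E; subst; apply: contra_neq nab => E; [by rewrite (rowI _ _ _ E)|].
by rewrite (colI _ _ _ E).
Qed.

(** Otherwise the walk through column [i], row [r], column [j], row [s], column [k] alternates
    between two colors. It is a 4-cycle if [i = k] and a path with four edges if not. *)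
Lemma star_grid_exchange : star_edge_coloring c ->
  forall r s i j k, r != s -> M r i = M s j -> M r j <> M s k.
Proof.
case/and3P=> pc Pp Pc r s i j k rs E1 E2.
have [rowI colI] := proper_grid.1 pc.
have ij : i != j by apply: contra_neq rs => ?; subst; exact: colI E1.
have jk : j != k by apply: contra_neq rs => ?; subst; exact: colI E2.
pose S := [tuple grid_edge r i; grid_edge r j; grid_edge s j; grid_edge s k].
have bS : bicolored c S.
  rewrite bicolored4; first by rewrite E1 E2 !eqxx.
  - by apply: contra_neq ij => /rowI.
  - by apply: contra_neq rs => /colI.
  - by apply: contra_neq jk => /rowI.
have [ik|ik] := eqVneq i k.
  have := forallP (forallP (forallP Pc (inr i)) [tuple inl r; inr j; inl s]) S.
  rewrite bS implybF => /negP[]; apply/and3P; split => //.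
    by rewrite /= !inE /= !negb_or !(inj_eq inl_inj, inj_eq inr_inj) ij rs.
  by rewrite /traverses /= -ik !(setUC [set inr _]).
have := forallP (forallP (forallP Pp (inr i)) [tuple inl r; inr j; inl s; inr k]) S.
rewrite bS implybF => /negP[]; apply/andP; split.
  rewrite /= !inE /= !negb_or !(inj_eq inl_inj, inj_eq inr_inj).
  by rewrite ij ik rs jk.
by rewrite /traverses /= !(setUC [set inr _]).
Qed.

(** The third hypothesis excludes alternating walks that start at a column vertex, the fourth those
    that start at a row vertex. *)
Lemma star_gridI :
    (forall r, injective (fun j => M r j)) ->
    (forall j, injective (fun r => M r j)) ->
    (forall r s i j k, r != s -> M r i = M s j -> M r j <> M s k) ->
    (forall r s t i j, i != j -> M r i = M s j -> M s i <> M t j) ->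
  star_edge_coloring c.
Proof.
move=> rowI colI exch share.
(* [v0 = v4] is allowed here, so that paths and 4-cycles are treated together. *)
have walk (v0 v1 v2 v3 v4 : K) (S : 4.-tuple (edge K)) :
    v0 != v2 -> v1 != v3 -> v2 != v4 -> traverses v0 [:: v1; v2; v3; v4] S ->
  ~~ bicolored c S.
  case: S => -[|e [|f [|g [|h [|? ?]]]]] //= _ n02 n13 n24 /eqP[].
  move=> /grid_edge_ends[r1 [j1 [-> H1]]] /grid_edge_ends[r2 [j2 [-> H2]]].
  move=> /grid_edge_ends[r3 [j3 [-> H3]]] /grid_edge_ends[r4 [j4 [-> H4]]].
  case: H1 => -[? ?]; subst v0 v1; case: H2 => -[] // [?] ?; subst;
  case: H3 => -[] // [?] ?; subst; case: H4 => -[] // [?] ?; subst;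
  rewrite !(inj_eq inl_inj, inj_eq inr_inj) in n02 n13 n24.
  - rewrite bicolored4; first 1 last.
    + by apply: contra_neq n02 => /colI.
    + by apply: contra_neq n13 => /rowI.
    + by apply: contra_neq n24 => /colI.
    by apply/negP=> /andP[/eqP E /eqP]; apply: share E.
  - rewrite bicolored4; first 1 last.
    + by apply: contra_neq n02 => /rowI.
    + by apply: contra_neq n13 => /colI.
    + by apply: contra_neq n24 => /rowI.
    by apply/negP=> /andP[/eqP E /eqP]; apply: exch E.
apply/and3P; split; first by apply/proper_grid.
- apply/forallP=> x; apply/forallP=> p; apply/forallP=> S; apply/implyP=> /andP[].
  case: p => -[|v1 [|v2 [|v3 [|v4 [|? ?]]]]] //= _.
  rewrite !inE !negb_or -!andbA => /and5P[_ x2 _ _ /and5P[_ n13 _ _ /andP[n24 _]]].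
  exact: walk.
- apply/forallP=> x; apply/forallP=> p; apply/forallP=> S; apply/implyP=> /and3P[_].
  case: p => -[|v1 [|v2 [|v3 [|? ?]]]] //= _.
  rewrite !inE !negb_or -!andbA => /and5P[_ x2 _ _ /andP[n13 _]].
  by apply: walk; rewrite // eq_sym.
Qed.

End Grid.

Lemma grid_coloring_ex (C : Type) (M : 'I_m -> 'I_n -> C) :
  exists c : edge K -> C, forall r j, c (grid_edge r j) = M r j.
Proof.
have ends a : {p | a = grid_edge p.1 p.2}.
  suff /sigW : exists p, a == grid_edge p.1 p.2 by case=> p /eqP; exists p.
  by have [r [j ->]] := grid_edgeP a; exists (r, j).
exists (fun a => M (sval (ends a)).1 (sval (ends a)).2) => r j.
by case: ends => p /= /grid_edge_inj[-> ->].
Qed.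

End GridColoring.

(** [enum_rank] renames colors injectively, which preserves every condition on [c]; pairs can thus
    serve as colors. *)
Lemma star_edge_colorable_card (G : sgraph) (C : finType) (c : edge G -> C) :
  star_edge_coloring c -> star_edge_colorable G #|C|.
Proof.
case/and3P=> pc Pp Pc.
have EC (a b : edge G) : ([ffun a => enum_rank (c a)] a ==
    [ffun a => enum_rank (c a)] b) = (c a == c b).
  by rewrite !ffunE (inj_eq enum_rank_inj).
have Eb s : bicolored [ffun a => enum_rank (c a)] s = bicolored c s.
  rewrite /bicolored (eq_map (g := enum_rank \o c)); last by move=> a; rewrite ffunE.
  by rewrite map_comp (undup_map_inj enum_rank_inj) size_map.
apply/existsP; exists [ffun a => enum_rank (c a)]; apply/and3P; split.
- apply/forallP=> a; apply/forallP=> b; rewrite EC.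
  exact: (forallP (forallP pc a) b).
- apply/forallP=> x; apply/forallP=> p; apply/forallP=> s; rewrite Eb.
  exact: (forallP (forallP (forallP Pp x) p) s).
- apply/forallP=> x; apply/forallP=> p; apply/forallP=> s; rewrite Eb.
  exact: (forallP (forallP (forallP Pc x) p) s).
Qed.

Lemma star_K3_lower (d t : nat) :
  star_edge_colorable (complete_bipartite 3 d) t -> 3 * uphalf d <= t.
Proof.
case/existsP=> c sc; pose M r j := c (grid_edge r j).
have [rowI _] := (proper_grid c).1 (andP sc).1.
have exch := star_grid_exchange sc.
pose R r := [set M r j | j in 'I_d].
have cR r : #|R r| = d by rewrite card_imset ?card_ord //; apply: rowI.
(* Common colors are counted by the columns where row [r] shows them: [P r s] and [P s r] both lie
   among the [d] columns, and the exchange property makes them disjoint. *)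
pose P r s := [set j | M r j \in R s].
have cP r s : #|P r s| = #|R r :&: R s|.
  rewrite -(card_imset _ (rowI r)); congr #|pred_of_set _|.
  apply/setP=> x; rewrite inE; apply/imsetP/andP => [[j jP ->]|[/imsetP[j _ ->] jR]].
    by rewrite inE in jP; split=> //; apply: imset_f.
  by exists j; rewrite ?inE.
have cRR r s : r != s -> #|R r :&: R s| <= d./2.
  move=> rs; suff : #|P r s| + #|P s r| <= d.
    by rewrite !cP (setIC (R s)); lia.
  rewrite -cardsUI (_ : P r s :&: P s r = set0) ?cards0 ?addn0.
    by rewrite -[leqRHS]card_ord max_card.
  apply/setP=> j; rewrite !inE; apply/negP=> /andP[].
  move=> /imsetP[k _ E1] /imsetP[i _ E2].
  by rewrite eq_sym in rs; apply: (exch _ _ k j i) (esym E1) E2 => //; rewrite eq_sym.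
pose r0 : 'I_3 := ord0; pose r1 : 'I_3 := lift ord0 ord0; pose r2 : 'I_3 := ord_max.
have h01 := cRR r0 r1 isT; have h02 := cRR r0 r2 isT; have h12 := cRR r1 r2 isT.
have u01 := cardsUI (R r0) (R r1); have := cardsUI (R r0 :|: R r1) (R r2).
(* This bounds the intersection of [R r2] with the union of the other two rows by the sum of the two
   pairwise intersections. *)
have := cardsUI (R r0 :&: R r2) (R r1 :&: R r2); rewrite -setIUl.
have := max_card (R r0 :|: R r1 :|: R r2); rewrite card_ord.
move: u01; rewrite !cR; lia.
Qed.

Lemma star_K3_upper (d k : nat) :
  2 < k -> d <= k.*2 -> star_edge_colorable (complete_bipartite 3 d) (3 * k).
Proof.
move=> k3 dk.
(* Even columns are of the first kind, odd ones of the second; [j./2] is the position within the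
   kind. As [j./2 < k] and [cls r j <= 2 < k], one subtraction of [k] reduces the index modulo
   [k]. *)
pose cls (r j : nat) := (r + 2 * odd j) %% 3.
pose idx (r j : nat) := let z := j./2 + odd j * cls r j in if z < k then z else z - k.
have cls_lt r j : cls r j < 3 by rewrite ltn_mod.
have half_lt (j : 'I_d) : j./2 < k by have := ltn_ord j; lia.
have idxP r (j : 'I_d) : let z := j./2 + odd j * cls r j in
    idx r j = z \/ idx r j + k = z.
  by rewrite /idx /=; case: ltnP; [left | right; lia].
have idx_lt r (j : 'I_d) : idx r j < k.
  have := cls_lt r j; have := half_lt j.
  by rewrite /idx; case: (odd j); case: ifP; lia.
pose M (r : 'I_3) (j : 'I_d) := (Ordinal (cls_lt r j), Ordinal (idx_lt r j)).
have ME r s i j : M r i = M s j -> cls r i = cls s j /\ idx r i = idx s j by case.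
have [c cE] := grid_coloring_ex M.
rewrite (_ : 3 * k = #|{: 'I_3 * 'I_k}|); last by rewrite card_prod !card_ord.
apply: (@star_edge_colorable_card _ _ c); apply: star_gridI.
- move=> r i j; rewrite !cE => /ME[]; rewrite /cls => E1 E2; apply: val_inj => /=.
  have Eo : odd i = odd j by move: E1; case: (odd i); case: (odd j); lia.
  move: (half_lt i) (half_lt j) (idxP r i) (idxP r j); rewrite E2 /cls Eo.
  have := odd_double_half i; have := odd_double_half j; rewrite Eo; lia.
- move=> j r s; rewrite !cE => /ME[]; rewrite /cls => E1 _; apply: val_inj => /=.
  have := ltn_ord r; have := ltn_ord s; lia.
(* The classes suffice: as [r] and [s] differ, [j] has parity opposite to both [i] and [l], so
   [r - s] would be both 2 and -2 modulo 3. *)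
- move=> r s i j l; rewrite !cE -(inj_eq val_inj) /= => rs /ME[E1 _] /ME[E2 _].
  move: rs E1 E2; rewrite /cls; have := ltn_ord r; have := ltn_ord s.
  by case: (odd i); case: (odd j); case: (odd l); lia.
(* For equal parities, a common color forces [i = j]. For opposite parities, the classes of the two
   common colors agree modulo [k], hence are equal because [k > 2], against [Eq]. *)
- move=> r s t i j; rewrite !cE -(inj_eq val_inj) /= => ij /ME[E1 F1] /ME[E2 F2].
  have Eq : cls s j = cls s i -> odd i = odd j.
    by rewrite /cls; case: (odd i); case: (odd j); lia.
  move: (idxP r i) (idxP s i) (idxP s j) (idxP t j) (cls_lt s j) (cls_lt s i) Eq.
  rewrite F1 F2 E1 -E2 => {E1 E2 F1 F2}.
  move: (cls s j) (cls s i) (idx s j) (idx t j) (half_lt i) (half_lt j) => q1 q2 z1 z2.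
  have := odd_double_half i; have := odd_double_half j.
  by case: (odd i); case: (odd j) => /=; lia.
Qed.

(* uphalf d = d.+1./2 is the ceiling of d/2 *)
Theorem theorem3 (d : nat) (hd : 5 <= d) :
  star_chromatic_index (complete_bipartite 3 d) = 3 * uphalf d.
Proof.
rewrite /star_chromatic_index; case: ex_minnP => t /star_K3_lower lo min.
(* The construction is used with [k = uphalf d], where [d >= 5] gives [k >= 3]. *)
by apply/eqP; rewrite eqn_leq lo min // star_K3_upper //; lia.
Qed.
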